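(* Let $p$ be a prime, let $1\le t\le m<p$, let $n\ge m$, and let $x_1,\dots,x_m\in GF(p)$ be public, pairwise distinct and nonzero. Then the modified Shamir secret sharing scheme with redundant shares (defined in the context) is ideal.
   Context: $GF(p)$ is the field with $p$ elements. Modified Shamir scheme with redundant shares: for a secret $S\in GF(p)$ the dealer draws $a_1,\dots,a_{t-1}$ independently and uniformly at random from $GF(p)$ (independently of $S$), forms $f(x)=S+a_1x+\cdots+a_{t-1}x^{t-1}$ over $GF(p)$, and distributes the values $f(x_1),\dots,f(x_m)$ to $n$ shareholders according to a fixed public surjective map $\sigma:\{1,\dots,n\}\to\{1,\dots,m\}$: shareholder $j$ receives the single share $f(x_{\sigma(j)})$. Shares of different shareholders $j\ne k$ with $\sigma(j)=\sigma(k)$ are copies of each other (mutual redundant shares); they are counted as different elements of a set of shares. A set of shares ''can reconstruct $S$'' if there is a function of the values of these shares (and the public data) which returns $S$ for every secret and all possible values of the dealer's random choices. The access structure of the scheme is the family of all sets of shares that can reconstruct $S$. A secret sharing scheme is perfect if no set of shares outside its access structure allows learning anything about the secret: for every probability distribution of $S$ on $GF(p)$ and every set of shares not in the access structure, the joint value of these shares is statistically independent of $S$. A secret sharing scheme is ideal if it is perfect and each shareholder's share lies in the same domain as the secret (here $GF(p)$). *)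

(* Defs.v *)
From HB Require Import structures.
From mathcomp Require Import all_boot all_order all_algebra.
From mathcomp Require Import reals.

Set Implicit Arguments.
Unset Strict Implicit.
Unset Printing Implicit Defensive.

Import Order.TTheory GRing.Theory Num.Theory.
Local Open Scope ring_scope.

Record fdist (R : realType) (T : finType) := FDist {
  pmf :> T -> R;
  pmf_ge0 : forall x, 0 <= pmf x;
  pmf_sum1 : \sum_x pmf x = 1 }.

Definition Pr (R : realType) (T : finType) (P : fdist R T) (E : pred T) : R :=
  \sum_(w | E w) P w.

Definition independent_rv (R : realType) (W : finType) (P : fdist R W)
    (T U : eqType) (X : W -> T) (Y : W -> U) : Prop :=
  forall x y,
    Pr P [pred w | (X w == x) && (Y w == y)] =
    Pr P [pred w | X w == x] * Pr P [pred w | Y w == y].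

Section Constructions.
Variable R : realType.

Section Uniform.
Variables (T : finType) (T_gt0 : (0 < #|T|)%N).

Let unif (_ : T) : R := #|T|%:R^-1.

Fact unif_ge0 x : 0 <= unif x. Proof. by rewrite invr_ge0 ler0n. Qed.

Fact unif_sum1 : \sum_x unif x = 1.
Proof.
by rewrite /unif sumr_const -[LHS]mulr_natl mulfV // pnatr_eq0 -lt0n.
Qed.

Definition uniform : fdist R T := FDist unif_ge0 unif_sum1.
End Uniform.

Section Product.
Variables (T U : finType) (P : fdist R T) (Q : fdist R U).

Let prodp (w : T * U) : R := P w.1 * Q w.2.

Fact prodp_ge0 w : 0 <= prodp w. Proof. by rewrite mulr_ge0 ?pmf_ge0. Qed.

Fact prodp_sum1 : \sum_w prodp w = 1.
Proof.
rewrite -(pair_bigA _ (fun x y => P x * Q y)) /=.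
under eq_bigr do rewrite -big_distrr /= pmf_sum1 mulr1.
exact: pmf_sum1.
Qed.

Definition fdist_prod : fdist R (T * U)%type := FDist prodp_ge0 prodp_sum1.
End Product.

(* Joint law of the independent family whose [i]-th member has law [P i]. *)
Section Family.
Variables (I T : finType) (P : I -> fdist R T).

Let famp (a : {ffun I -> T}) : R := \prod_i P i (a i).

Fact famp_ge0 a : 0 <= famp a.
Proof. by apply: prodr_ge0 => i _; apply: pmf_ge0. Qed.

Fact famp_sum1 : \sum_a famp a = 1.
Proof.
rewrite -(bigA_distr_bigA (fun i x => P i x)) /=.
by apply: big1 => i _; apply: pmf_sum1.
Qed.

Definition fdist_family : fdist R {ffun I -> T} := FDist famp_ge0 famp_sum1.
End Family.

End Constructions.

(* [H] is the set of shareholders.  Each shareholder [j] gets exactly one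
   share, with values in a domain [share_dom j] of its own. *)
Record scheme (R : realType) (H : finType) := Scheme {
  secret : finType;
  rand : finType;
  dealer : fdist R rand;
  share_dom : H -> finType;
  share : forall j : H, secret -> rand -> share_dom j }.

Section Schemes.
Variables (R : realType) (H : finType) (S : scheme R H).

(* A set of shares is given by the set [A] of the shareholders holding them,
   so that equal shares of different shareholders count as different. *)
Definition shares_val (A : {set H}) : finType :=
  {dffun forall j : {j : H | j \in A}, share_dom S (val j)}.

Definition shares (A : {set H}) (s : secret S) (r : rand S) : shares_val A :=
  [ffun j : {j : H | j \in A} => share (val j) s r].

Definition can_reconstruct (A : {set H}) : Prop :=
  exists g : shares_val A -> secret S,
    forall (s : secret S) (r : rand S), 0 < dealer S r -> g (shares A s r) = s.

Definition access_structure : {set H} -> Prop :=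
  fun A => can_reconstruct A.

(* The secret, of law [Q], is independent of the dealer's random choices. *)
Definition perfect : Prop :=
  forall (Q : fdist R (secret S)) (A : {set H}),
    ~ access_structure A ->
    independent_rv (fdist_prod Q (dealer S))
      (fun w => shares A w.1 w.2) (fun w => w.1).

Definition ideal : Prop :=
  perfect /\ forall j : H, share_dom S j = secret S.

End Schemes.

Section Shamir.
Variables (R : realType) (p t m n : nat).
Variables (x : 'I_m -> 'F_p) (sigma : 'I_n -> 'I_m).

(* [a i] is the coefficient of degree [i.+1]. *)
Definition shamir_poly (s : 'F_p) (a : {ffun 'I_t.-1 -> 'F_p}) : {poly 'F_p} :=
  s%:P + \sum_(i < t.-1) a i *: 'X^(i.+1).

Fact card_Fp_gt0 : (0 < #|'F_p|)%N.
Proof. by apply/card_gt0P; exists 0. Qed.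

Definition modified_shamir : scheme R 'I_n :=
  @Scheme R 'I_n 'F_p {ffun 'I_t.-1 -> 'F_p}
    (fdist_family (fun _ : 'I_t.-1 => uniform R card_Fp_gt0))
    (fun _ : 'I_n => 'F_p)
    (fun j s a => (shamir_poly s a).[x (sigma j)]).

End Shamir.

(* Main.v *)
Require Import Defs.
From mathcomp Require Import all_boot all_order all_algebra.
From mathcomp Require Import reals.

(** Let [B] be the set of distinct evaluation points held by a set of
    shareholders.  If [B] has at least [t] points, two dealer polynomials
    (of size at most [t]) that agree on [B] are equal, so the shares determine
    the secret.  Otherwise, for every [c], the polynomial
    [c * \prod_(b in B) (1 - X / b)] has size at most [t], vanishes on [B] and
    takes the value [c] at [0]: adding it to the dealer's polynomial is a
    bijection between the random choices for two secrets that keeps all the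
    shares in question, so the law of these shares does not depend on the
    secret. *)

Set Implicit Arguments.
Unset Strict Implicit.
Unset Printing Implicit Defensive.

Import Order.TTheory GRing.Theory Num.Theory.
Local Open Scope ring_scope.

(** Averaging over [Q] a conditional law that is the same for every [u] returns that law, so both
    sides equal [Q u] times it. *)
Lemma fdist_prod_independent (R : realType) (U V : finType) (T : eqType)
    (Q : fdist R U) (P : fdist R V) (X : U -> V -> T) :
    (forall u u' x, Pr P [pred v | X u v == x] = Pr P [pred v | X u' v == x]) ->
  independent_rv (fdist_prod Q P) (fun w => X w.1 w.2) (fun w => w.1).
Proof.
move=> lawX x u; rewrite /Pr /=.
have Q1 : \sum_u' Q u' = 1 := pmf_sum1 Q.
have split_sum (E : pred (U * V)) : \sum_(w | E w) Q w.1 * P w.2 =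
    \sum_u' Q u' * \sum_(v | E (u', v)) P v.
  under [RHS]eq_bigr do rewrite big_distrr.
  by rewrite pair_big_dep; apply: eq_bigl => -[].
rewrite !split_sum /=.
have -> : \sum_u' Q u' * \sum_(v | X u' v == x) P v =
    \sum_(v | X u v == x) P v.
  rewrite -[RHS]mul1r -Q1 big_distrl; apply: eq_bigr => u' _.
  by congr (_ * _); apply: lawX.
have -> : \sum_u' Q u' * \sum_(v | u' == u) P v = Q u.
  rewrite (bigD1 u) //= eqxx pmf_sum1 mulr1 big1 ?addr0 // => u' /negPf ->.
  by rewrite big_pred0_eq mulr0.
rewrite (bigD1 u) //= [X in _ + X]big1 ?addr0 => [|u' /negPf u'u].
  by rewrite mulrC; congr (_ * _); apply: eq_bigl => v; rewrite eqxx andbT.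
by rewrite big_pred0 ?mulr0 // => v; rewrite u'u andbF.
Qed.

(** All families have the same mass, so reindexing by [h] changes no summand. *)
Lemma uniform_family_Pr_bij (R : realType) (I T : finType) (T_gt0 : (0 < #|T|)%N)
    (E F : pred {ffun I -> T}) (h : {ffun I -> T} -> {ffun I -> T}) :
    bijective h -> (forall a, E (h a) = F a) ->
  let P := fdist_family (fun _ : I => uniform R T_gt0) in Pr P E = Pr P F.
Proof.
move=> h_bij EhF P; rewrite /Pr (reindex h) /=; last exact: onW_bij.
by apply: eq_big => // a _; apply: eq_bigr.
Qed.

Section ShamirPoly.
Variables (p t : nat).

Lemma coef_shamir_poly (s : 'F_p) (a : {ffun 'I_t.-1 -> 'F_p}) k :
  (shamir_poly s a)`_k =
    if k is k'.+1 then oapp a 0 (insub k') else s.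
Proof.
rewrite coefD coefC coef_sum; case: k => [|k] /=.
  by rewrite big1 ?addr0 // => i _; rewrite coefZ coefXn mulr0.
rewrite add0r; case: insubP => [i _ <-|k_ge] /=.
  rewrite (bigD1 i) //= coefZ coefXn eqxx mulr1 big1 ?addr0 // => j ji.
  by rewrite coefZ coefXn eqSS eq_sym [_ == _ :> nat](negPf ji) mulr0.
rewrite big1 // => i _; rewrite coefZ coefXn eqSS.
by case: eqP k_ge => [->|]; rewrite ?ltn_ord ?mulr0.
Qed.

Lemma size_shamir_poly (s : 'F_p) (a : {ffun 'I_t.-1 -> 'F_p}) :
  (0 < t)%N -> (size (shamir_poly s a) <= t)%N.
Proof.
move=> t_gt0; apply/leq_sizeP => -[|k]; first by rewrite leqNgt t_gt0.
rewrite coef_shamir_poly; case: insubP => //= i.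
by rewrite -ltnS prednK // ltnNge => /negPf ->.
Qed.

Lemma shamir_polyD (s s' : 'F_p) (a a' : {ffun 'I_t.-1 -> 'F_p}) :
  shamir_poly (s + s') (a + a') = shamir_poly s a + shamir_poly s' a'.
Proof.
apply/polyP => -[|k]; rewrite coefD !coef_shamir_poly //.
by case: insubP => [i _ _|_] /=; rewrite ?ffunE ?addr0.
Qed.

Lemma shamir_polyE (q : {poly 'F_p}) : (size q <= t)%N ->
  q = shamir_poly q.[0] [ffun i : 'I_t.-1 => q`_i.+1].
Proof.
move=> /leq_sizeP q_size; apply/polyP => -[|k]; rewrite coef_shamir_poly.
  by rewrite horner_coef0.
case: insubP => [i _ <-|] /=; first by rewrite ffunE.
by rewrite -leqNgt => k_ge; rewrite q_size // (leq_trans (leqSpred t)).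
Qed.

End ShamirPoly.

Lemma exists_poly_vanishing (F : fieldType) (rs : seq F) (c : F) :
    0 \notin rs ->
  exists q : {poly F},
    [/\ (size q <= (size rs).+1)%N, q.[0] = c & forall z, z \in rs -> q.[z] = 0].
Proof.
move=> rs_neq0; pose w := \prod_(z <- rs) ('X - z%:P).
have w0 : w.[0] != 0 by rewrite -/(root w 0) root_prod_XsubC.
(* This is [c * \prod_z (1 - X / z)], with the denominators gathered in [w.[0]]. *)
exists ((c / w.[0]) *: w); split.
- by rewrite (leq_trans (size_scale_leq _ _)) // size_prod_XsubC.
- by rewrite hornerZ divfK.
- move=> z z_rs; have /rootP wz : root w z by rewrite root_prod_XsubC.
  by rewrite hornerZ wz mulr0.
Qed.

Section ModifiedShamir.
Variables (R : realType) (p t m n : nat) (t_gt0 : (0 < t)%N).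
Variables (x : 'I_m -> 'F_p) (x_inj : injective x) (x_neq0 : forall i, x i != 0).
Variables (sigma : 'I_n -> 'I_m).
Let S := @modified_shamir R p t m n x sigma.

(** Redundant copies repeat the same test, so [A] matters only through [sigma @: A]. *)
Lemma modified_shamir_shares_eq (A : {set 'I_n}) (s s' : 'F_p)
    (a a' : {ffun 'I_t.-1 -> 'F_p}) :
  (shares (S := S) A s a == shares (S := S) A s' a') =
  all (fun z => (shamir_poly s a).[z] == (shamir_poly s' a').[z])
    [seq x i | i in sigma @: A].
Proof.
apply/eqP/allP => [eq_sh z /imageP[i /imsetP[j jA ->] ->]|eq_sh].
  by have /ffunP/(_ (Sub j jA)) := eq_sh; rewrite !ffunE /= => ->.
apply/ffunP => -[j jA]; rewrite !ffunE /=; apply/eqP/eq_sh.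
exact/image_f/imset_f.
Qed.

Lemma modified_shamir_reconstruct (A : {set 'I_n}) :
  (t <= #|sigma @: A|)%N -> can_reconstruct S A.
Proof.
move=> t_le.
have uniq_secret (s s' : 'F_p) (a a' : {ffun 'I_t.-1 -> 'F_p}) :
    shares (S := S) A s a = shares (S := S) A s' a' -> s = s'.
  move/eqP; rewrite modified_shamir_shares_eq => eq_ev.
  suff /(congr1 (fun q : {poly 'F_p} => q`_0)) : shamir_poly s a = shamir_poly s' a'.
    by rewrite !coef_shamir_poly.
  apply/eqP; rewrite -subr_eq0; apply/negPn/negP => neq0.
  (* A nonzero difference has fewer roots than its size, which is at most [t]; yet it vanishes at
     [t] or more distinct points. *)
  suff : (size [seq x i | i in sigma @: A] <
      size (shamir_poly s a - shamir_poly s' a')%R)%N.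
    rewrite ltnNge size_image (leq_trans _ t_le) //.
    by rewrite (leq_trans (size_polyD _ _)) // size_polyN geq_max !size_shamir_poly.
  apply: max_poly_roots => //; last by rewrite map_inj_uniq ?enum_uniq.
  by apply: sub_all eq_ev => z; rewrite rootE !hornerE subr_eq0.
(* Search for a secret compatible with [v]; the default [0] is reached only when no secret yields
   [v]. *)
exists (fun v => odflt 0 [pick s | [exists a, shares (S := S) A s a == v]]) => s a _.
case: pickP => [s' /existsP[a' /eqP /uniq_secret //]|/(_ s)/existsP[]].
by exists a.
Qed.

Lemma modified_shamir_shares_law (A : {set 'I_n}) (s s' : 'F_p)
    (v : shares_val S A) : (#|sigma @: A| < t)%N ->
  Pr (dealer S) [pred a | shares (S := S) A s a == v] =
  Pr (dealer S) [pred a | shares (S := S) A s' a == v].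
Proof.
move=> lt_t.
have points_neq0 : 0 \notin [seq x i | i in sigma @: A].
  by apply/imageP => -[i _ /eqP]; rewrite eq_sym (negPf (x_neq0 i)).
have [q [q_size q0 qz]] := exists_poly_vanishing (s - s') points_neq0.
(* The strict bound on [#|sigma @: A|] leaves room for the extra coefficient that fixes [q.[0]]. *)
rewrite size_image in q_size; have q_le := leq_trans q_size lt_t.
pose c : {ffun 'I_t.-1 -> 'F_p} := [ffun i : 'I_t.-1 => q`_i.+1].
(* Passing from [(s', a)] to [(s, a + c)] adds exactly [q] to the dealer's polynomial. *)
apply: (@uniform_family_Pr_bij _ _ _ _ _ _ (+%R^~ c)).
  by exists (fun a => a - c) => a; rewrite ?addrK ?subrK.
move=> a /=; congr (_ == _); apply/eqP; rewrite modified_shamir_shares_eq.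
apply/allP => z /qz qz0.
have -> : s = s' + q.[0] by rewrite q0 addrC subrK.
by rewrite shamir_polyD -shamir_polyE // hornerD qz0 addr0.
Qed.

End ModifiedShamir.

Theorem lemma8 (R : realType) (p t m n : nat)
    (hp : prime p) (ht : (1 <= t)%N) (htm : (t <= m)%N) (hmp : (m < p)%N)
    (hmn : (m <= n)%N)
    (x : 'I_m -> 'F_p) (x_inj : injective x) (x_neq0 : forall i, x i != 0)
    (sigma : 'I_n -> 'I_m) (sigma_surj : forall i, exists j, sigma j = i) :
  ideal (@modified_shamir R p t m n x sigma).
Proof.
split=> // Q A not_rec; apply: fdist_prod_independent => s s' v.
(* By contraposition, a set outside the access structure holds fewer than [t] distinct points. *)
apply: modified_shamir_shares_law => //; rewrite ltnNge; apply/negP => t_le.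
exact/not_rec/modified_shamir_reconstruct.
Qed.
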